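(* For every $n>0$, the core label order $\mathrm{CLO}(\mathrm{Hoch}(n))$ of the Hochschild lattice $\mathrm{Hoch}(n)$ is isomorphic, as a poset, to the shuffle lattice $\mathrm{Shuf}(n-1,1)$.
   Context: Hochschild lattice. For $n\geq 1$, a triword of length $n$ is a tuple $u=(u_1,\ldots,u_n)$ such that (T1) $u_i\in\{0,1,2\}$ for all $i$; (T2) $u_1\neq 2$; (T3) if $u_i=0$, then $u_j\neq 1$ for all $j>i$. Let $\mathrm{Tri}(n)$ be the set of all triwords of length $n$. The Hochschild lattice is $\mathrm{Hoch}(n)=(\mathrm{Tri}(n),\leq)$ where $\leq$ is the componentwise order. It is known to be a semidistributive lattice: the join is the componentwise maximum, and the meet is obtained by taking the componentwise minimum and then replacing by $0$ every entry $1$ that has an entry $0$ somewhere to its left. Core label order. Let $L$ be a finite semidistributive lattice. For a cover relation $a\lessdot b$ put $\lambda(a,b)=\min\{c\in L\mid a\vee c=b\}$; this minimum exists and is join irreducible. The nucleus of $a\in L$ is $a_\downarrow=a\wedge\bigwedge_{b\lessdot a}b$. The core label set of $a$ is $\Psi(a)=\{\lambda(b,b')\mid a_\downarrow\leq b\lessdot b'\leq a\}$. The map $a\mapsto\Psi(a)$ is injective. The core label order $\mathrm{CLO}(L)$ is the poset $(L,\sqsubseteq)$ where $a\sqsubseteq b$ if and only if $\Psi(a)\subseteq\Psi(b)$. Shuffle lattice. Let $A=\{a_1,\ldots,a_k\}$ and $B=\{b_1,\ldots,b_l\}$ be disjoint sets of $k$ and $l$ letters. The elements of $\mathrm{Shuf}(k,l)$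 are all words $w$ over $A\uplus B$ such that the restriction of $w$ to letters in $A$ is a (not necessarily contiguous, possibly empty) subword of $a_1a_2\cdots a_k$ and the restriction of $w$ to letters in $B$ is a subword of $b_1b_2\cdots b_l$. The order is: $w_1\preceq w_2$ if and only if $w_2$ can be obtained from $w_1$ by removing letters of $A$ and/or adding letters of $B$. *)

(* Defs.v *)
From HB Require Import structures.
From mathcomp Require Import all_boot all_order.
From mathcomp Require Import zify.
From Stdlib Require Import Relation_Operators.

Set Implicit Arguments.
Unset Strict Implicit.
Unset Printing Implicit Defensive.

Import Order.TTheory.
Local Open Scope order_scope.

Section CoreLabelOrder.
Context {d : Order.disp_t} {L : finTBLatticeType d}.
Implicit Types a b c : L.

Definition covers a b : bool := (a < b) && [forall c, ~~ (a < c < b)].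

(* In a poset, [arg min_(c < x | P c) c] is the minimum of {c | P c} if there
   is one, and x otherwise. When L is semidistributive the minimum exists for
   every cover relation (a, b), so the default b is never used. *)
Definition lambda a b : L := [arg min_(c < b | a `|` c == b) c].

Definition nucleus a : L := a `&` \meet_(b | covers b a) b.

Definition core_label_set a : {set L} :=
  [set lambda b b' | b in L, b' in L &
     [&& nucleus a <= b, covers b b' & b' <= a]].

Definition core_label_le a b : bool :=
  core_label_set a \subset core_label_set b.

End CoreLabelOrder.

(* Positions are numbered from 0: the letter u_i is u (i - 1). *)
Definition is_triword n (u : {ffun 'I_n -> 'I_3}) : bool :=
  [forall i : 'I_n, (i == 0 :> nat) ==> (u i != 2 :> nat)] &&
  [forall i : 'I_n, forall j : 'I_n,
     (i < j)%N ==> (u i == 0 :> nat) ==> (u j != 1 :> nat)].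

Record triword n := Triword {
  triword_val :> {ffun 'I_n -> 'I_3};
  triwordP : is_triword triword_val
}.

HB.instance Definition _ n := [isSub for @triword_val n].
HB.instance Definition _ n := [Finite of triword n by <:].

Section Hochschild.
Variable n : nat.
Implicit Types u v w : triword n.

Lemma triword_T2 u (i : 'I_n) : i = 0 :> nat -> u i != 2 :> nat.
Proof.
by move=> i0; case/andP: (triwordP u) => /forallP/(_ i); rewrite i0.
Qed.

Lemma triword_T3 u (i j : 'I_n) :
  (i < j)%N -> u i = 0 :> nat -> u j != 1 :> nat.
Proof.
move=> ij ui; case/andP: (triwordP u) => _ /forallP/(_ i)/forallP/(_ j).
by rewrite ij ui.
Qed.

Lemma is_triwordI (f : {ffun 'I_n -> 'I_3}) :
  (forall i : 'I_n, i = 0 :> nat -> f i != 2 :> nat) ->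
  (forall i j : 'I_n, (i < j)%N -> f i = 0 :> nat -> f j != 1 :> nat) ->
  is_triword f.
Proof.
move=> T2 T3; apply/andP; split.
  by apply/forallP => i; apply/implyP => /eqP; apply: T2.
apply/forallP => i; apply/forallP => j; apply/implyP => ij.
by apply/implyP => /eqP; apply: T3.
Qed.

Definition tri_le u v : bool := [forall i, (u i <= v i)%N].

Fact tri_le_refl : reflexive tri_le.
Proof. by move=> u; apply/forallP => i. Qed.

Fact tri_le_anti : antisymmetric tri_le.
Proof.
move=> u v /andP[/forallP uv /forallP vu]; apply/val_inj/ffunP => i.
by apply/val_inj/eqP; rewrite eqn_leq uv vu.
Qed.

Fact tri_le_trans : transitive tri_le.
Proof.
move=> v u w /forallP uv /forallP vw; apply/forallP => i.
exact: leq_trans (uv i) (vw i).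
Qed.

Definition tri_join_val u v : {ffun 'I_n -> 'I_3} :=
  [ffun i => Order.max (u i) (v i)].

Definition tri_min u v : {ffun 'I_n -> 'I_3} :=
  [ffun i => Order.min (u i) (v i)].

Definition tri_meet_val u v : {ffun 'I_n -> 'I_3} :=
  [ffun i : 'I_n =>
     if (tri_min u v i == 1 :> nat) &&
        [exists j : 'I_n, (j < i)%N && (tri_min u v j == 0 :> nat)]
     then ord0 else tri_min u v i].

Definition tri_bot_val : {ffun 'I_n -> 'I_3} := [ffun=> ord0].

Definition tri_top_val : {ffun 'I_n -> 'I_3} :=
  [ffun i : 'I_n => if i == 0 :> nat then inord 1 else inord 2].

Lemma val_tri_join u v i : tri_join_val u v i = maxn (u i) (v i) :> nat.
Proof. by rewrite ffunE /Order.max ltEord; case: ltnP => h; lia. Qed.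

Lemma val_tri_min u v i : tri_min u v i = minn (u i) (v i) :> nat.
Proof. by rewrite ffunE /Order.min ltEord; case: ltnP => h; lia. Qed.

Lemma tri_joinP u v : is_triword (tri_join_val u v).
Proof.
apply: is_triwordI => [i i0|i j ij]; rewrite !val_tri_join.
  by have := triword_T2 u i0; have := triword_T2 v i0; lia.
move=> uv0; have := @triword_T3 u i j ij; have := @triword_T3 v i j ij; lia.
Qed.

Lemma tri_meetP u v : is_triword (tri_meet_val u v).
Proof.
apply: is_triwordI => [i i0|i j ij].
  rewrite ffunE; case: ifP => // _; rewrite val_tri_min.
  by have := triword_T2 u i0; have := triword_T2 v i0; lia.
rewrite [_ i]ffunE [_ j]ffunE; case: ifP => [/andP[_ /existsP[k /andP[ki k0]]] _|_ i0].
  case: ifP => //; have -> /= : [exists k : 'I_n,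
    (k < j)%N && (tri_min u v k == 0 :> nat)].
    by apply/existsP; exists k; rewrite k0 (ltn_trans ki ij).
  by rewrite andbT => ->.
case: ifP => //; have -> /= : [exists k : 'I_n,
  (k < j)%N && (tri_min u v k == 0 :> nat)].
  by apply/existsP; exists i; rewrite ij i0 eqxx.
by rewrite andbT => ->.
Qed.

Lemma tri_botP : is_triword tri_bot_val.
Proof. by apply: is_triwordI => [i|i j _]; rewrite !ffunE. Qed.

Lemma tri_topP : is_triword tri_top_val.
Proof.
apply: is_triwordI => [i i0|i j _]; rewrite !ffunE.
  by rewrite i0 eqxx inordK.
by case: ifP => _; rewrite inordK.
Qed.

Definition tri_join u v : triword n := Triword (tri_joinP u v).
Definition tri_meet u v : triword n := Triword (tri_meetP u v).
Definition tri_bot : triword n := Triword tri_botP.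
Definition tri_top : triword n := Triword tri_topP.

Fact tri_lexI u v w : tri_le u (tri_meet v w) = tri_le u v && tri_le u w.
Proof.
apply/forallP/andP => [h|[/forallP uv /forallP uw] i].
  have {}h i : (u i <= minn (v i) (w i))%N.
    apply: leq_trans (h i) _; rewrite -val_tri_min /= ffunE.
    by case: ifP.
  by split; apply/forallP => i; move: (h i); lia.
have h k : (u k <= tri_min v w k)%N.
  by rewrite val_tri_min leq_min uv uw.
rewrite /= ffunE; case: ifP => // /andP[/eqP m1 /existsP[j /andP[ji /eqP m0]]].
have := h i; have := h j; have := @triword_T3 u j i ji; rewrite m0 m1 /=; lia.
Qed.

Fact tri_leUx u v w : tri_le (tri_join u v) w = tri_le u w && tri_le v w.
Proof.
apply/forallP/andP => [h|[/forallP uw /forallP vw] i].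
  by split; apply/forallP => i; move: (h i); rewrite val_tri_join; lia.
by rewrite val_tri_join geq_max uw vw.
Qed.

Fact tri_le0x u : tri_le tri_bot u.
Proof. by apply/forallP => i; rewrite ffunE. Qed.

Fact tri_lex1 u : tri_le u tri_top.
Proof.
apply/forallP => i; rewrite ffunE; have := ltn_ord (u i).
by case: ifP => [/eqP/(triword_T2 u)|_]; rewrite inordK //; lia.
Qed.

End Hochschild.

Fact hoch_display : Order.disp_t. Proof. exact: Order.Disp tt tt. Qed.

HB.instance Definition _ n := Order.Le_isPOrder.Build hoch_display (triword n)
  (@tri_le_refl n) (@tri_le_anti n) (@tri_le_trans n).
HB.instance Definition _ n := Order.POrder_MeetJoin_isLattice.Build
  hoch_display (triword n) (@tri_lexI n) (@tri_leUx n).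
HB.instance Definition _ n :=
  Order.hasBottom.Build hoch_display (triword n) (@tri_le0x n).
HB.instance Definition _ n :=
  Order.hasTop.Build hoch_display (triword n) (@tri_lex1 n).

Definition hoch n : finTBLatticeType hoch_display := triword n.

Section Shuffle.
Variables k l : nat.

(* inl i is the letter a_(i+1) and inr j is the letter b_(j+1). *)
Definition letter : eqType := ('I_k + 'I_l)%type.

Definition restrA (w : seq letter) : seq 'I_k :=
  pmap (fun x : letter => if x is inl i then Some i else None) w.

Definition restrB (w : seq letter) : seq 'I_l :=
  pmap (fun x : letter => if x is inr j then Some j else None) w.

(* enum 'I_k is the increasing sequence 0, ..., k - 1. *)
Definition is_shuffle (w : seq letter) : bool :=
  subseq (restrA w) (enum 'I_k) && subseq (restrB w) (enum 'I_l).

Definition shuf : Type := {w : seq letter | is_shuffle w}.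

Inductive shuf_step : seq letter -> seq letter -> Prop :=
  | RemoveA (s t : seq letter) (i : 'I_k) :
      shuf_step (s ++ inl i :: t) (s ++ t)
  | AddB (s t : seq letter) (j : 'I_l) :
      shuf_step (s ++ t) (s ++ inr j :: t).

(* The intermediate words of a sequence of steps from one element of shuf to
   another are again elements of shuf, since letters of A are never added and
   letters of B are never removed. *)
Definition shuf_le (w1 w2 : shuf) : Prop :=
  clos_refl_trans (seq letter) shuf_step (sval w1) (sval w2).

End Shuffle.

(* Main.v *)
(* Every cover relation of Hoch(n) is labelled by one of the join irreducibles
   [two i] (a single 2, at position i) and [ones i] (1 up to position i).
   The core label set of u consists of the [two i] with u_i = 2, together with
   the [ones i] such that no 0 occurs up to i and no 1 after i. Comparing these
   sets, u is below v in CLO(Hoch(n)) iff every 2 of u is a 2 of v and, when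
   u_1 = 1, every entry of v other than 2 agrees with u.
   The positions 2, ..., n with u_i <> 2 are read as letters of A: first those
   with u_i = 1, then the letter b if u_1 = 1, then those with u_i = 0. By (T3)
   this is a shuffle word, and changing entries to 2 deletes letters of A. *)

Require Import Defs.
From mathcomp Require Import all_boot all_order.
From mathcomp Require Import zify.
From Stdlib Require Import Relation_Operators.

Set Implicit Arguments.
Unset Strict Implicit.
Unset Printing Implicit Defensive.

Import Order.TTheory.

(** * Cover labels and nuclei in a finite lattice *)

Lemma lambda_eq {d} {L : finTBLatticeType d} (a b c : L) :
  Order.join a c = b -> (forall x : L, Order.join a x = b -> (c <= x)%O) ->
  lambda a b = c.
Proof.
move=> ac cmin; rewrite /lambda /Order.arg_min /extremum; case: pickP => [x|/(_ c)].
  case/andP=> /eqP ax /forallP/(_ c)/implyP; rewrite ac eqxx => /(_ isT) xc.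
  by apply/le_anti; rewrite xc cmin.
(* The search behind [arg_min] cannot fail, since [c] itself qualifies; the default [b] never
   intervenes. *)
rewrite /= ac eqxx /= => /forallP[] x; apply/implyP => /eqP; exact: cmin.
Qed.

Lemma covers_join {d} {L : finTBLatticeType d} (a b c : L) :
  covers a b -> (c <= b)%O -> ~~ (c <= a)%O -> Order.join a c = b.
Proof.
case/andP => ab /forallP/(_ (Order.join a c)) ncov cb ca.
apply/eqP; move: ncov; rewrite !lt_neqAle leUl leUx cb (ltW ab) !andbT /=.
rewrite negb_and !negbK => /orP[/eqP aac|//].
by rewrite aac leUr in ca.
Qed.

Lemma le_nucleusP {d} {L : finTBLatticeType d} (a c : L) :
  reflect ((c <= a)%O /\ forall b, covers b a -> (c <= b)%O) (c <= nucleus a)%O.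
Proof. by rewrite lexI; apply: (iffP andP) => -[ca /meetsP]. Qed.

Lemma nucleus_le {d} {L : finTBLatticeType d} (a b : L) :
  covers b a -> (nucleus a <= b)%O.
Proof. by have [_] := elimT (le_nucleusP a _) (lexx _); apply. Qed.

(** * Join irreducible triwords, cover relations and their labels *)

Section Triwords.
Variable n : nat.
Implicit Types (u v w : triword n) (i j k : 'I_n).

Lemma tri_leP u v : reflect (forall i, u i <= v i) ((u : hoch n) <= v)%O.
Proof. exact: forallP. Qed.

Lemma tri_eqP u v : (forall i, u i = v i :> nat) -> u = v.
Proof. by move=> uv; apply/val_inj/ffunP => i; apply/val_inj/uv. Qed.

Lemma tri_joinE (u v : hoch n) i : (Order.join u v : triword n) i =
  maxn ((u : triword n) i) ((v : triword n) i) :> nat.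
Proof. exact: val_tri_join. Qed.

Definition ones_val i : {ffun 'I_n -> 'I_3} := [ffun j : 'I_n => inord (j <= i)].

Definition two_val i : {ffun 'I_n -> 'I_3} :=
  [ffun j : 'I_n => inord (((j == i) && (0 < i)) * 2)].

Lemma val_ones i j : ones_val i j = (j <= i) :> nat.
Proof. by rewrite ffunE inordK //; case: (j <= i). Qed.

Lemma val_two i j : two_val i j = ((j == i) && (0 < i)) * 2 :> nat.
Proof. by rewrite ffunE inordK //; case: (_ && _). Qed.

Lemma onesP i : is_triword (ones_val i).
Proof. by apply: is_triwordI => [j|j k]; rewrite !val_ones; lia. Qed.

Lemma twoP i : is_triword (two_val i).
Proof.
apply: is_triwordI => [j|j k]; rewrite !val_two.
  by case: (j =P i) => [->|]; lia.
by case: ((k == i) && _).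
Qed.

Definition ones i : triword n := Triword (onesP i).

(* For [i = 0] the word [two i] is not join irreducible but the bottom. *)
Definition two i : triword n := Triword (twoP i).

Lemma triword_before_one u i : u i = 1 :> nat -> forall j, j <= i -> u j != 0 :> nat.
Proof.
move=> ui j; case: ltngtP => [ji _|//|/val_inj -> _]; last by rewrite ui.
by apply/eqP => /(triword_T3 ji); rewrite ui.
Qed.

Lemma ones_leP i u :
  reflect (forall j, j <= i -> u j != 0 :> nat) ((ones i : hoch n) <= u)%O.
Proof.
apply: (iffP (tri_leP _ _)) => [le_u j ji|le_u j]; rewrite ?val_ones.
  by have := le_u j; rewrite val_ones ji; lia.
by case: (leqP j i) => [/le_u|_]; lia.
Qed.

Lemma triword_bound u i : u i <= 2.
Proof. by rewrite -ltnS. Qed.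

Lemma two_le i u : 0 < i -> ((two i : hoch n) <= u)%O = (u i == 2 :> nat).
Proof.
move=> i0; have ui := triword_bound u i.
apply/tri_leP/eqP => [/(_ i)|{}ui j]; rewrite val_two i0 andbT.
  by rewrite eqxx; lia.
by case: eqP => [->|//]; rewrite ui.
Qed.

(** A triword strictly in between could differ from both only at [i], where the only value left is
    1; a 0 further left excludes it by (T3). *)
Lemma covers_one_step u v i : (forall j, j != i -> v j = u j :> nat) ->
  v i < u i -> (u i = (v i).+1 :> nat) \/ (exists2 j : 'I_n, j < i & v j = 0 :> nat) ->
  covers (v : hoch n) (u : hoch n).
Proof.
move=> eq_uv lt_uv gap; apply/andP; split.
  rewrite lt_neqAle; apply/andP; split.
    by apply/eqP => uv; rewrite uv ltnn in lt_uv.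
  by apply/tri_leP => j; have [->|/eq_uv ->] := eqVneq j i; first exact: ltnW.
apply/forallP => w; apply/negP => /andP[].
rewrite !lt_neqAle => /andP[vw /tri_leP le_vw] /andP[wu /tri_leP le_wu].
have eq_w j : j != i -> w j = u j :> nat.
  by move=> ji; have := le_vw j; have := le_wu j; have := eq_uv _ ji; lia.
have wi : v i < w i < u i.
  apply/andP; split; rewrite ltn_neqAle ?le_vw ?le_wu andbT.
    apply: contra_neq vw => vwi; apply: tri_eqP => j.
    by have [->|ji] := eqVneq j i; rewrite ?vwi // eq_w // eq_uv.
  apply: contra_neq wu => wui; apply: tri_eqP => j.
  by have [->|ji] := eqVneq j i; rewrite ?wui // eq_w.
case: gap => [|[j ji v0]]; first by lia.
have := triword_bound u i; have := @triword_T3 n w j i ji.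
have := eq_w j; have := eq_uv j; rewrite -val_eqE /=; lia.
Qed.


(** As [v] has no 2 at [i], a word whose join with [v] is [u] must supply that 2 itself. *)
Lemma lambda_two u v i : covers (v : hoch n) (u : hoch n) ->
  v i != 2 :> nat -> u i = 2 :> nat -> lambda (v : hoch n) (u : hoch n) = two i.
Proof.
move=> cov vi ui; have i0 : 0 < i.
  by rewrite lt0n; apply/eqP => /(triword_T2 u); rewrite ui.
apply: lambda_eq => [|w]; first by apply: covers_join; rewrite // two_le // ui.
move/(congr1 (fun w : triword n => w i : nat)); rewrite tri_joinE two_le //; lia.
Qed.

(** A word whose join with [v] is [u] needs a 1 at [i], and by (T3) it then has no 0 up to [i]. *)
Lemma lambda_ones u v i : covers (v : hoch n) (u : hoch n) ->
  v i = 0 :> nat -> u i = 1 :> nat -> lambda (v : hoch n) (u : hoch n) = ones i.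
Proof.
move=> cov vi ui; apply: lambda_eq => [|w].
  apply: covers_join => //; first by apply/ones_leP/triword_before_one.
  by apply/ones_leP => /(_ i (leqnn _)); rewrite vi.
move/(congr1 (fun w : triword n => w i : nat)); rewrite tri_joinE => wi.
by apply/ones_leP/triword_before_one; lia.
Qed.

(** Any position where a cover increases reveals its label, so the label set is described without
    [lambda]. *)
Lemma core_labelP u (c : hoch n) :
  reflect (exists v w i, [/\ (nucleus (u : hoch n) <= v)%O,
    covers (v : hoch n) (w : hoch n), ((w : hoch n) <= u)%O, v i < w i & c = if w i == 2 :> nat then two i else ones i])
    (c \in core_label_set (u : hoch n)).
Proof.
apply: (iffP imset2P) => [[v w _]|[v [w [i [nuc cov wu vwi ->]]]]]; last first.
  exists v w; rewrite ?inE ?nuc ?cov //.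
  have wb := triword_bound w i; case: eqP => wi.
    by rewrite (lambda_two cov (i := i)) //; lia.
  by rewrite (lambda_ones cov (i := i)) //; lia.
rewrite !inE /= => /and3P[nuc cov wu] ->; case/andP: (cov) => lt_vw _.
have le_vw := elimT (tri_leP _ _) (ltW lt_vw).
case: (boolP [exists i, (v : triword n) i < (w : triword n) i])
  => [/existsP[i vwi]|]; last first.
  rewrite negb_exists => /forallP ge; have vw : v = w.
    by apply: tri_eqP => i; have := ge i; have := le_vw i; lia.
  by rewrite vw ltxx in lt_vw.
exists v, w, i; split=> //; have wb := triword_bound w i; case: eqP => wi.
  by apply: lambda_two => //; lia.
by apply: lambda_ones => //; lia.
Qed.

(** * Lower covers, which bound the nucleus from above *)

Lemma lower_cover_two u i : u i = 2 :> nat ->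
  exists2 v : triword n, covers (v : hoch n) (u : hoch n) & v i <= 1.
Proof.
(* [b] is the value replacing the 2 at [i]: it is 1 unless a 0 stands to the left, when (T3) forces
   0. *)
move=> ui; pose b := [forall k : 'I_n, (k < i) ==> (u k != 0 :> nat)].
pose f : {ffun 'I_n -> 'I_3} := [ffun j => if j == i then inord b else u j].
have i0 : 0 < i by rewrite lt0n; apply/eqP => /(triword_T2 u); rewrite ui.
have fi : f i = b :> nat by rewrite ffunE eqxx inordK // ltnS (leq_trans (leq_b1 b)).
have fj j : j != i -> f j = u j by rewrite ffunE => /negPf->.
have fP : is_triword f.
  apply: is_triwordI => [j j0|j k jk].
    have ji : j != i by rewrite -val_eqE /= j0; lia.
    by rewrite fj // triword_T2.
  have [ji|ji] := eqVneq j i; have [ki|ki] := eqVneq k i.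
  - by rewrite ji ki ltnn in jk.
  - rewrite {1}ji fi fj // => b0.
    have /forallPn[l] : ~~ b by rewrite -eqb0 b0.
    rewrite negb_imply negbK => /andP[li /eqP ul].
    by apply: triword_T3 ul; rewrite ji in jk; apply: ltn_trans jk.
  - rewrite ki fi fj // => uj; have -> // : b = false.
    by apply/negbTE/forallPn; exists j; rewrite uj; rewrite ki in jk; rewrite jk.
  - by rewrite !fj //; apply: triword_T3.
exists (Triword fP); last by rewrite /= fi leq_b1.
apply: (@covers_one_step _ _ i) => [j ji||]; rewrite /= ?fi ?ui; first by rewrite fj.
  by rewrite ltnS leq_b1.
case: (boolP b) => [_|]; first by left.
rewrite negb_forall => /existsP[j]; rewrite negb_imply negbK => /andP[ji /eqP uj].
by right; exists j => //; rewrite /= fj // -val_eqE /=; lia.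
Qed.

(** The last 1 can become 0 without violating (T3), as no 1 follows it. *)
Lemma lower_cover_one u i : u i = 1 :> nat -> (forall j, i < j -> u j != 1 :> nat) ->
  exists2 v : triword n, covers (v : hoch n) (u : hoch n) & v i = 0 :> nat.
Proof.
move=> ui no1.
pose f : {ffun 'I_n -> 'I_3} := [ffun j => if j == i then inord 0 else u j].
have fi : f i = 0 :> nat by rewrite ffunE eqxx inordK.
have fj j : j != i -> f j = u j by rewrite ffunE => /negPf->.
have fP : is_triword f.
  apply: is_triwordI => [j j0|j k jk].
    by have [->|ji] := eqVneq j i; rewrite ?fi // fj // triword_T2.
  have [->|ki] := eqVneq k i; rewrite ?fi // (fj k) //.
  have [ji _|ji] := eqVneq j i; first by apply: no1; rewrite -ji.
  by rewrite fj //; apply: triword_T3.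
exists (Triword fP) => //.
by apply: (@covers_one_step _ _ i) => [j ji||]; rewrite /= ?fi ?ui //; [rewrite fj|left].
Qed.

(** * Core label sets of triwords *)

Lemma core_label_twoP u i : 0 < i ->
  reflect (u i = 2 :> nat) ((two i : hoch n) \in core_label_set (u : hoch n)).
Proof.
move=> i0; apply: (iffP (core_labelP _ _)) => [[v [w [k [_ _ /tri_leP wu _]]]]|ui].
  move/(congr1 (fun w : triword n => w i : nat)); rewrite val_two eqxx i0 /=.
  case: eqP => wk; last by rewrite val_ones; case: (_ <= _).
  rewrite val_two; case: eqP => // ik _; rewrite -ik in wk.
  by have := wu i; have := triword_bound u i; lia.
have [v cov vi] := lower_cover_two ui; exists v, u, i.
by rewrite ui eqxx; split => //; exact: nucleus_le.
Qed.

Lemma core_label_onesP u i :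
  reflect ((forall j, j <= i -> u j != 0 :> nat) /\
           (forall j, i < j -> u j != 1 :> nat))
    ((ones i : hoch n) \in core_label_set (u : hoch n)).
Proof.
apply: (iffP (core_labelP _ _)) => [[v [w [k [nuc _ /tri_leP wu vwk]]]]|[no0 no1]].
  have wb := triword_bound w k.
  case: eqP => wk eq_ik.
    move/(congr1 (fun w : triword n => w i : nat)): eq_ik.
    by rewrite val_two val_ones leqnn; case: (_ && _).
  have ik : i = k.
    have := congr1 (fun w : triword n => w i : nat) eq_ik.
    have := congr1 (fun w : triword n => w k : nat) eq_ik.
    rewrite !val_ones !leqnn => ki ik; apply/val_inj/eqP; rewrite eqn_leq.
    by case: (k <= i) ki => //; case: (i <= k) ik.
  subst k; have {wk} wi : w i = 1 :> nat by lia.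
  have no0 j : j <= i -> u j != 0 :> nat.
    by move=> /(triword_before_one wi); have := wu j; lia.
  split=> // j ij; apply/eqP => uj.
  (* With a 1 of [u] at [j > i], every lower cover [x] of [u] is above [ones i]: otherwise its join
     with [ones i] is [u], so [x] has a 1 at [j] and by (T3) no 0 up to [j]. Hence [ones i] is below
     the nucleus and below [v], although [v] is 0 at [i]. *)
  have : ((ones i : hoch n) <= v)%O.
    apply: le_trans nuc; apply/le_nucleusP; split=> [|x cov]; first exact/ones_leP.
    apply/negPn/negP => xi.
    have := covers_join cov (introT (ones_leP _ _) no0) xi.
    move/(congr1 (fun w : triword n => w j : nat)); 
    rewrite tri_joinE val_ones leqNgt ij maxn0 uj => xj.
    case/ones_leP: xi => k ki; apply: (triword_before_one xj).
    exact: leq_trans ki (ltnW ij).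
  by move/ones_leP/(_ i (leqnn _)); lia.
(* The cover labelled [ones i] is taken right below [ones i]: [f] is 1 strictly before [i], and is
   the bottom when [i] is the first position. *)
pose f : {ffun 'I_n -> 'I_3} := [ffun j : 'I_n => inord (j < i)].
have fE j : f j = (j < i) :> nat by rewrite ffunE inordK //; case: (j < i).
have fP : is_triword f by apply: is_triwordI => [j|j k]; rewrite !fE; lia.
exists (Triword fP), (ones i), i; rewrite val_ones leqnn /= fE ltnn.
have [ord0 ord0E] : exists k : 'I_n, k = 0 :> nat.
  by exists (Ordinal (leq_ltn_trans (leq0n i) (ltn_ord i))).
have u0 : u ord0 == 1 :> nat.
  by have := triword_bound u ord0; have := triword_T2 u ord0E; have := no0 ord0; lia.
split => //; last 2 first.
- apply: (@covers_one_step _ _ i) => [j|/=|]; rewrite ?fE ?val_ones ?ltnn ?leqnn //.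
    by rewrite -val_eqE /= => ji; congr nat_of_bool; lia.
  by left.
- exact/ones_leP.
(* Lowering the last 1 of [u], at [l <= i], puts a 0 of the nucleus at [l]; (T3) then excludes 1
   from the nucleus after [l]. *)
case: (@arg_maxnP _ ord0 (fun k => u k == 1 :> nat) (fun k => k : nat) u0)
    => l /eqP ul maxl.
have [|v cov vl] := lower_cover_one ul.
  by move=> j lj; apply/eqP => uj; have := maxl j; rewrite uj; lia.
have li : l <= i by rewrite leqNgt; apply/negP => /no1; rewrite ul.
have nucl := elimT (tri_leP _ _) (nucleus_le cov).
apply/tri_leP => j; rewrite fE.
(* Every 2 of [u] is lowered by some lower cover, so the nucleus has no 2. *)
have le1 : (nucleus (u : hoch n) : triword n) j <= 1.
  have := triword_bound u j; rewrite leq_eqVlt => /orP[/eqP /lower_cover_two|].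
    by case=> x /nucleus_le/tri_leP/(_ j); lia.
  have /tri_leP/(_ j) : (nucleus (u : hoch n) <= u)%O by exact: leIl.
  lia.
case: (ltnP j i) => // ij.
case: (ltngtP l j) => [lj|jl|/val_inj <-]; [|lia|by have := nucl l; lia].
have := @triword_T3 n (nucleus (u : hoch n)) l j lj; have := nucl l; lia.
Qed.

End Triwords.

(** * Comparison of core label sets *)

Lemma core_label_leP m (u v : triword m.+1) :
  reflect (forall i, v i = 2 :> nat \/ u i <> 2 :> nat /\
             (u ord0 != 0 :> nat -> v i = u i :> nat))
    (core_label_le (u : hoch m.+1) (v : hoch m.+1)).
Proof.
apply: (iffP subsetP) => [sub_uv i|R c].
  have two_uv j : u j = 2 :> nat -> v j = 2 :> nat.
    move=> uj; have j0 : 0 < j.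
      by rewrite lt0n; apply/eqP => /(triword_T2 u); rewrite uj.
    by apply/(core_label_twoP _ j0)/sub_uv/core_label_twoP.
  have [vi|/eqP vi] := eqVneq (v i : nat) 2; [by left | right].
  split=> [/two_uv//|u0].
  have {}u0 : u ord0 == 1 :> nat.
    by have := triword_bound u ord0; have := @triword_T2 _ u ord0 erefl; lia.
  (* With [l] the last 1 of [u], [ones l] is a label of [u] and so of [v]: outside their 2s, both
     words are 1 up to [l] and 0 afterwards. *)
  case: (@arg_maxnP _ ord0 (fun k => u k == 1 :> nat) (fun k => k : nat) u0)
    => l /eqP ul maxl.
  have [no0 no1] : (forall j : 'I_m.+1, j <= l -> v j != 0 :> nat) /\
      (forall j : 'I_m.+1, l < j -> v j != 1 :> nat).
    apply/core_label_onesP/sub_uv/core_label_onesP; split.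
      exact: triword_before_one.
    by move=> j lj; apply/eqP => uj; have := maxl j; rewrite uj; lia.
  have := triword_bound u i; have := triword_bound v i; have := two_uv i.
  have := no0 i; have := no1 i; have := maxl i; have := @triword_before_one _ u l ul i.
  lia.
case/core_labelP => x [w [i [nuc cov wu xwi ->]]].
have : (if w i == 2 :> nat then two i else ones i : hoch m.+1)
  \in core_label_set (u : hoch m.+1).
  by apply/core_labelP; exists x, w, i.
case: eqP => wi.
  have i0 : 0 < i by rewrite lt0n; apply/eqP => /(triword_T2 w); rewrite wi.
  move/(core_label_twoP _ i0) => ui; apply/core_label_twoP => //.
  by case: (R i) => [//|[]].
case/core_label_onesP => no0 no1; apply/core_label_onesP.
have u0 := no0 ord0 (leq0n _).
by split=> j ji; have := R j; have := no0 j; have := no1 j; lia.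
Qed.

(** * Shuffle steps when B has a single letter *)

(** No element of [p] comes after one of [q], so listing those of [p] first keeps the order of [s].
    This serves for the 1s and 0s of a triword. *)
Lemma filter_cat_filter (T : Type) (p q : pred T) (s : seq T) :
  pairwise (fun z t => q z ==> ~~ p t) s -> (forall z, p z -> ~~ q z) ->
  filter p s ++ filter q s = filter (predU p q) s.
Proof.
move=> pw dis; elim: s pw => //= z s IH /andP[qz /IH <-].
case: ifP => pz /=; first by rewrite (negPf (dis _ pz)).
case: ifP qz => qz //= allN; suff -> : filter p s = [::] by [].
by apply/nilP; rewrite /nilp size_filter eqn0Ngt -has_count -all_predC.
Qed.

Section Words.
Variable m : nat.
Local Notation word := (seq (letter m 1)).
Local Notation steps := (clos_refl_trans word (@shuf_step m 1)).
Local Notation la := (inl : 'I_m -> letter m 1).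
Local Notation b := (inr ord0 : letter m 1).
Implicit Types (s t w : word) (u v : triword m.+1) (x y : seq 'I_m).

Definition before_b w := take (index b w) w.

Lemma before_b_cat s t :
  before_b (s ++ t) = if b \in s then before_b s else s ++ before_b t.
Proof.
rewrite /before_b index_cat take_cat; case: (boolP (b \in s)) => bs; first by rewrite index_mem bs.
by rewrite ltnNge leq_addr /= addKn.
Qed.

Lemma before_b_cons t : before_b (b :: t) = [::].
Proof. by []. Qed.

Lemma before_b_la i t : before_b (la i :: t) = la i :: before_b t.
Proof. by []. Qed.

Lemma shuf_step_rev w1 w2 : shuf_step w1 w2 -> shuf_step (rev w1) (rev w2).
Proof.
by case=> s t i; rewrite !rev_cat rev_cons -cats1 -catA /=; constructor.
Qed.

(** Removing a letter of A or inserting another [b] can only shrink the prefix before the first [b].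
    Intermediate words are arbitrary here, so [b] may occur several times. *)
Lemma steps_before w1 w2 : steps w1 w2 -> b \in w1 ->
  b \in w2 /\ {subset before_b w2 <= before_b w1}.
Proof.
elim=> {w1 w2} [w1 w2|w bw|w1 w2 w3 _ IH1 _ IH2 /IH1[/IH2[b3 s32] s21]]; last 2 first.
  by split.
  by split=> // z /s32/s21.
case=> s t i; rewrite !before_b_cat !mem_cat !inE /= => bst.
  split=> // z; rewrite before_b_la; case: ifP => // _.
  by rewrite !mem_cat inE => /orP[]->; rewrite ?orbT.
rewrite [i]ord1 before_b_cons cats0 eqxx orbT; split=> // z; case: ifP => // _.
by rewrite mem_cat => ->.
Qed.

(** Through reversal, [steps_before] also controls the letters after the last [b]. *)
Lemma steps_rev w1 w2 : steps w1 w2 -> steps (rev w1) (rev w2).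
Proof.
elim=> {w1 w2} [w1 w2 /shuf_step_rev|w|w1 w2 w3 _ IH1 _ IH2].
- exact: rt_step.
- exact: rt_refl.
- exact: rt_trans IH1 IH2.
Qed.

Lemma steps_la w1 w2 i : steps w1 w2 -> la i \in w2 -> la i \in w1.
Proof.
elim=> {w1 w2} [w1 w2|w //|w1 w2 w3 _ IH1 _ IH2 /IH2/IH1//].
by case=> s t j; rewrite !mem_cat inE //= => /orP[]->; rewrite ?orbT.
Qed.

Lemma steps_subseq x y s t : subseq x y ->
  steps (s ++ map la y ++ t) (s ++ map la x ++ t).
Proof.
elim: y x s => [|j y IH] [|i x] s //=; try by move=> _; apply: rt_refl.
  move=> _; apply: rt_trans (IH [::] s (sub0seq _)); apply: rt_step; exact: RemoveA.
case: eqP => [->|_] xy.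
  by have := IH x (rcons s (la j)) xy; rewrite !cat_rcons.
apply: rt_trans (IH (i :: x) s xy); apply: rt_step; exact: RemoveA.
Qed.

(** * The shuffle word of a triword *)

(** Letter [j] of A encodes position [lift ord0 j]; the first position is reserved for [b]. *)
Definition selection c u := [seq j <- enum 'I_m | u (lift ord0 j) == c :> nat].

Definition shuffle_word u : word :=
  map la (selection 1 u) ++ nseq (u ord0 != 0 :> nat) b ++ map la (selection 0 u).

Lemma mem_selection c u j : (j \in selection c u) = (u (lift ord0 j) == c :> nat).
Proof. by rewrite mem_filter mem_enum andbT. Qed.

Lemma mem_map_la i x : (la i \in map la x) = (i \in x).
Proof. by apply: mem_map => ? ? []. Qed.

Lemma b_notin_map_la x : b \notin map la x.
Proof. by apply/mapP => -[]. Qed.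

Lemma la_shuffle_word u j : (la j \in shuffle_word u) = (u (lift ord0 j) != 2 :> nat).
Proof.
rewrite !mem_cat !mem_map_la !mem_selection mem_nseq andbC /=.
by have := triword_bound u (lift ord0 j); lia.
Qed.

Lemma b_shuffle_word u : (b \in shuffle_word u) = (u ord0 != 0 :> nat).
Proof.
rewrite !mem_cat (negPf (b_notin_map_la _)) (negPf (b_notin_map_la _)) orbF.
by rewrite mem_nseq eqxx andbT lt0b.
Qed.

Lemma before_b_shuffle_word u : u ord0 != 0 :> nat ->
  before_b (shuffle_word u) = map la (selection 1 u) /\
  before_b (rev (shuffle_word u)) = rev (map la (selection 0 u)).
Proof.
rewrite /shuffle_word => -> /=.
rewrite rev_cat rev_cons -cats1 -catA /= !before_b_cat !before_b_cons !cats0.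
by rewrite mem_rev !(negPf (b_notin_map_la _)).
Qed.

Lemma pairwise_enum : pairwise (fun i j : 'I_m => i < j) (enum 'I_m).
Proof.
by rewrite -(pairwise_map val ltn) val_enum_ord -sorted_pairwise ?iota_ltn_sorted //; apply: ltn_trans.
Qed.

(** By (T3) no 1 follows a 0, so the 1s followed by the 0s already stand in increasing order of
    position. *)
Lemma selection_cat u :
  selection 1 u ++ selection 0 u = [seq j <- enum 'I_m | u (lift ord0 j) != 2 :> nat].
Proof.
rewrite filter_cat_filter => [|//|j]; last by lia.
  by apply: eq_filter => j /=; have := triword_bound u (lift ord0 j); lia.
apply: sub_pairwise pairwise_enum => i j ij; apply/implyP => /eqP.
by apply: triword_T3; rewrite !lift0.
Qed.

Lemma restrA_map_la x : restrA (map la x) = x.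
Proof. by elim: x => //= j x ->. Qed.

Lemma restrB_map_la x : restrB (map la x) = [::].
Proof. by elim: x. Qed.

Lemma map_la_restrA w : restrB w = [::] -> map la (restrA w) = w.
Proof. by elim: w => //= -[i|j] w IH //= /IH ->. Qed.

Lemma shuffle_wordP u : is_shuffle (shuffle_word u).
Proof.
rewrite /is_shuffle /shuffle_word /restrA /restrB !pmap_cat -!/(restrA _) -!/(restrB _).
rewrite !restrA_map_la !restrB_map_la cats0 /=; apply/andP; split.
  suff -> : restrA (nseq (u ord0 != 0 :> nat) b) = [::] by rewrite selection_cat filter_subseq.
  by case: (_ != _).
by rewrite enum_ordSl; case: (u ord0 != 0 :> nat) => //=; apply: sub0seq.
Qed.

Lemma shuffle_word_steps u v : steps (shuffle_word u) (shuffle_word v) <->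
  (forall i, v i = 2 :> nat \/ u i <> 2 :> nat /\
             (u ord0 != 0 :> nat -> v i = u i :> nat)).
Proof.
have u02 := @triword_T2 _ u ord0 erefl; have v02 := @triword_T2 _ v ord0 erefl.
have ub := triword_bound u; have vb := triword_bound v.
split=> [uv i|R].
  have bvu : u ord0 != 0 :> nat -> v ord0 != 0 :> nat.
    by rewrite -!b_shuffle_word => /(steps_before uv)[].
  case: (unliftP ord0 i) => [j|] ->; last first.
    by have := ub ord0; have := vb ord0; lia.
  have := vb (lift ord0 j); have := @steps_la _ _ j uv; rewrite !la_shuffle_word => uv2 vj2.
  have [|vj] := eqVneq (v (lift ord0 j) : nat) 2; [by left|right].
  split; first exact/eqP/uv2.
  move=> u0; have v0 := bvu u0.
  (* The 1s stand before [b] and the 0s after it; each side can only lose letters, so an entry of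
     [v] other than 2 agrees with [u]. *)
  have [_] := steps_before uv (etrans (b_shuffle_word u) u0).
  have [|_] := steps_before (steps_rev uv).
    by rewrite mem_rev b_shuffle_word.
  have [-> ->] := before_b_shuffle_word u0; have [-> ->] := before_b_shuffle_word v0.
  move=> /(_ (la j)); rewrite !mem_rev !mem_map_la !mem_selection => s0.
  move=> /(_ (la j)); rewrite !mem_map_la !mem_selection; lia.
(* If [b] is already present, letters are removed on each side of it separately. *)
have [u0|u0] := eqVneq (u ord0 : nat) 0; last first.
  have v0 : v ord0 = u ord0 :> nat by case: (R ord0) => [|[]]; lia.
  have sub c : c < 2 -> subseq (selection c v) (selection c u).
    move=> c2; rewrite subseq_filter filter_subseq andbT; apply/allP => j.
    by rewrite mem_selection; have := R (lift ord0 j); lia.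
  rewrite /shuffle_word v0.
  apply: rt_trans (steps_subseq [::] _ (sub 1 isT)) _.
  rewrite !catA; set s := map la (selection 1 v) ++ _.
  have := steps_subseq s [::] (sub 0 isT).
  by rewrite !cats0.
(* If [u] starts with 0, it has no 1 by (T3), so all its letters lie in [selection 0 u]; after the
   removals [b] is inserted where [v] requires it. *)
have sel1 : selection 1 u = [::].
  rewrite /selection (eq_filter (a2 := pred0)) ?filter_pred0 // => j /=.
  by apply/negbTE/(triword_T3 (i := ord0)); rewrite // lift0.
rewrite /shuffle_word sel1 u0 /=.
have sub : subseq (selection 1 v ++ selection 0 v) (selection 0 u).
  rewrite subseq_filter selection_cat filter_subseq andbT; apply/allP => j.
  rewrite mem_filter => /andP[vj _].
  have : j \notin selection 1 u by rewrite sel1.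
  by rewrite mem_selection; have := ub (lift ord0 j); have := R (lift ord0 j); lia.
have := steps_subseq [::] [::] sub; rewrite /= !cats0 map_cat => st.
apply: rt_trans st _; case: (v ord0 != 0 :> nat) => /=.
  by apply: rt_step; apply: AddB.
exact: rt_refl.
Qed.

(** * Every shuffle word comes from a triword *)

Lemma shuffle_word_onto (c : bool) x y :
  subseq (x ++ y) (enum 'I_m) -> (~~ c -> x = [::]) ->
  exists u, shuffle_word u = map la x ++ nseq c b ++ map la y.
Proof.
move=> xy cx.
have uniq_enum := enum_uniq 'I_m.
have := subseq_uniq xy uniq_enum; rewrite cat_uniq => /and3P[_ /hasPn dis _].
have := subseq_pairwise xy pairwise_enum; rewrite pairwise_cat => /andP[/allrelP lt_xy _].
(* Letters in [x] become 1, those in [y] become 0, missing ones 2. (T3) holds since [x] precedes [y]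
   in the enumeration, and [x] is empty when the first entry is 0. *)
pose f : {ffun 'I_m.+1 -> 'I_3} := [ffun i => inord
  (if unlift ord0 i is Some j
   then if j \in x then 1 else if j \in y then 0 else 2 else c)].
have f0 : f ord0 = c :> nat by rewrite ffunE unlift_none inordK //; case: (c).
have fl j : f (lift ord0 j) = (if j \in x then 1 else if j \in y then 0 else 2) :> nat.
  by rewrite ffunE liftK inordK //; do 2?case: ifP.
have fP : is_triword f.
  apply: is_triwordI => [i|i j].
    by case: (unliftP ord0 i) => [k|] -> //; rewrite f0; case: (c).
  case: (unliftP ord0 j) => [j'|] -> //; rewrite fl.
  case: (unliftP ord0 i) => [i'|] -> ; rewrite ?fl ?f0 !lift0.
    case: ifP => // _; case: ifP => // iy; case: ifP => [jx|_]; last by case: ifP.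
    by have := lt_xy _ _ jx iy; lia.
  by move=> _ c0; rewrite cx ?in_nil; [case: ifP|case: (c) c0].
exists (Triword fP); rewrite /shuffle_word /= f0; congr (map la _ ++ nseq _ _ ++ map la _).
- have /(subseq_uniqP uniq_enum) -> := subseq_trans (prefix_subseq x y) xy.
  by apply: eq_filter => j /=; rewrite fl; case: ifP => // _; case: ifP.
- by case: (c).
- have /(subseq_uniqP uniq_enum) -> := subseq_trans (suffix_subseq x y) xy.
  apply: eq_filter => j /=; rewrite fl; case: (boolP (j \in y)) => [/dis/negPf->//|_].
  by case: ifP.
Qed.

Lemma shuffle_word_surj w : is_shuffle w -> exists u, shuffle_word u = w.
Proof.
case: (boolP (b \in w)) => [|bw]; last first.
  have Bw : restrB w = [::].
    by elim: w bw => //= -[i|j] w IH; rewrite inE //= [j]ord1 eqxx.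
  (* Without [b] the first entry is 0, so all letters must be read as 0s. *)
  case/andP=> Aw _; have [|u uE] := @shuffle_word_onto false [::] (restrA w) Aw; first by [].
  by exists u; rewrite uE /= map_la_restrA.
case/splitPr => s t /andP[]; rewrite /restrA /restrB !pmap_cat /= -!/(restrA _) -!/(restrB _).
(* B has one letter, so splitting at [b] leaves no letter of B on either side. *)
move=> Ast /size_subseq; rewrite size_enum_ord size_cat /= addnS ltnS leqn0 addn_eq0 !size_eq0.
move=> /andP[/eqP Bs /eqP Bt].
have [|u uE] := @shuffle_word_onto true _ _ Ast; first by [].
by exists u; rewrite uE !map_la_restrA.
Qed.

End Words.

Theorem theorem1p3 (n : nat) (hn : 0 < n) :
  exists f : hoch n -> shuf n.-1 1,
    bijective f /\
    forall u v : hoch n, core_label_le u v <-> shuf_le (f u) (f v).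
Proof.
case: n hn => // m _ /=.
pose f (u : hoch m.+1) : shuf m 1 := exist (fun w => is_shuffle w) _ (shuffle_wordP u).
have f_le (u v : hoch m.+1) : core_label_le u v <-> shuf_le (f u) (f v).
  split; first by move/core_label_leP/shuffle_word_steps.
  by move/shuffle_word_steps => ?; apply/core_label_leP.
exists f; split=> //.
(* Comparability both ways gives equal 2s and equal first entries; if these are 1 the words agree,
   and if they are 0, (T3) leaves only 0 outside the 2s. *)
have f_inj : injective f.
  move=> u v fuv; apply: tri_eqP => i.
  have /core_label_leP/(_ i) : core_label_le u v by apply/f_le; rewrite fuv; apply: rt_refl.
  have /core_label_leP : core_label_le v u by apply/f_le; rewrite fuv; apply: rt_refl.
  move=> vu; have := vu i; have := vu ord0.
  have := triword_bound u i; have := triword_bound v i.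
  have := @triword_T3 _ u ord0 i; have := @triword_T3 _ v ord0 i.
  case: (unliftP ord0 i) => [j|] ->;
    rewrite ?lift0 /=; have := @triword_T2 _ u ord0 erefl;
    have := @triword_T2 _ v ord0 erefl; lia.
have f_onto w : exists u, f u == w.
  by have [u uw] := shuffle_word_surj (svalP w); exists u; apply/eqP/val_inj.
exists (fun w => xchoose (f_onto w)) => [u|w].
  by apply: f_inj; apply/eqP; exact: (xchooseP (f_onto (f u))).
exact/eqP/(xchooseP (f_onto w)).
Qed.
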